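(* Suppose that $$\begin{bmatrix}H_{11}&0\\0&H_{22}\end{bmatrix}+\begin{bmatrix}\Sigma_1&0\\0&\Sigma_2\end{bmatrix}+\begin{bmatrix}A_1^\top A_1&0\\0&A_2^\top A_2\end{bmatrix}+\begin{bmatrix}R_1&0\\0&R_2\end{bmatrix}\succ0 .$$ Let $\{(x_1^k,x_2^k,\mu^k)\}$ be generated by the 2-block proximal ADMM (described in the context) to solve the problem $$\min_{x_1\in\mathbb{R}^{d_1},\,x_2\in\mathbb{R}^{d_2}}\ \theta_1(x_1)+\theta_2(x_2)+\phi(x_1,x_2)\quad\text{s.t.}\quad A_1x_1+A_2x_2=b .$$ Then the sequence $\{(x_1^k,x_2^k,\mu^k)\}$ converges to a KKT point of this problem.
   Context: Setting: $\theta_i:\mathbb{R}^{d_i}\to(-\infty,+\infty]$ ($i=1,2$) are closed proper convex functions, $d=d_1+d_2$, $A_i\in\mathbb{R}^{m\times d_i}$, $b\in\mathbb{R}^m$, $g=(g_1,g_2)\in\mathbb{R}^{d}$, $H=\begin{bmatrix}H_{11}&H_{12}\\H_{12}^\top&H_{22}\end{bmatrix}\in\mathbb{R}^{d\times d}$ is symmetric positive semidefinite with $H_{ij}\in\mathbb{R}^{d_i\times d_j}$, and $$\phi(x_1,x_2)=\tfrac12x_1^\top H_{11}x_1+x_1^\top H_{12}x_2+\tfrac12x_2^\top H_{22}x_2+g_1^\top x_1+g_2^\top x_2 .$$ A KKT point is a triple $(\bar x_1,\bar x_2,\bar\mu)$ with $-\nabla_{x_i}\phi(\bar x_1,\bar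 x_2)+A_i^\top\bar\mu\in\partial\theta_i(\bar x_i)$ for $i=1,2$ and $A_1\bar x_1+A_2\bar x_2=b$; the set of KKT points is assumed nonempty. Here $\partial\theta_i$ is the convex subdifferential. $\Sigma_1,\Sigma_2$ are symmetric positive semidefinite matrices such that, for $i=1,2$, $(x_i-\hat x_i)^\top(w_i-\hat w_i)\ge\|x_i-\hat x_i\|^2_{\Sigma_i}$ for all $x_i,\hat x_i\in\mathrm{dom}(\theta_i)$, $w_i\in\partial\theta_i(x_i)$, $\hat w_i\in\partial\theta_i(\hat x_i)$. For a symmetric positive semidefinite $G$, $\|v\|_G^2=v^\top Gv$; $\succ0$ means positive definite. 2-block proximal ADMM: let $\beta>0$ and let $R_i\in\mathbb{R}^{d_i\times d_i}$ ($i=1,2$) be symmetric positive semidefinite. From an initial $(x_1^0,x_2^0,\mu^0)$, for $k\ge 0$: $$\begin{aligned} x_1^{k+1}&:=\arg\min_{x_1}\Big\{\theta_1(x_1)+\phi(x_1,x_2^k)-(\mu^k)^\top A_1x_1+\tfrac\beta2\|A_1x_1+A_2x_2^k-b\|^2+\tfrac12\|x_1-x_1^k\|^2_{R_1}\Big\},\\ x_2^{k+1}&:=\arg\min_{x_2}\Big\{\theta_2(x_2)+\phi(x_1^{k+1},x_2)-(\mu^k)^\top A_2x_2+\tfrac\beta2\|A_1x_1^{k+1}+A_2x_2-b\|^2+\tfrac12\|x_2-x_2^k\|^2_{R_2}\Big\},\\ \mu^{k+1}&:=\mu^k-\beta(A_1x_1^{k+1}+A_2x_2^{k+1}-b). \end{aligned}$$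 *)

(* Defs.v *)
From HB Require Import structures.
From mathcomp Require Import all_boot all_order all_algebra.
From mathcomp Require Import all_classical all_reals all_analysis.
Import Order.TTheory GRing.Theory Num.Theory.
Import numFieldNormedType.Exports.

Set Implicit Arguments.
Unset Strict Implicit.
Unset Printing Implicit Defensive.

Local Open Scope classical_set_scope.
Local Open Scope ring_scope.

Section LinearAlgebra.
Context {R : realType}.

Definition dot n (u v : 'cV[R]_n) : R := (u^T *m v) 0 0.

(* The squared seminorm v^T G v; G = 1%:M gives the squared Euclidean norm
   (the library norm `|v| on matrices is the sup norm). *)
Definition sqnorm n (G : 'M[R]_n) (v : 'cV[R]_n) : R := dot v (G *m v).

Definition psd n (G : 'M[R]_n) : Prop :=
  G^T = G /\ forall v, 0 <= sqnorm G v.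

Definition posdef n (G : 'M[R]_n) : Prop :=
  G^T = G /\ forall v, v != 0 -> 0 < sqnorm G v.

End LinearAlgebra.

Section ConvexAnalysis.
Context {R : realType} {n : nat}.
Implicit Types (f : 'cV[R]_n -> \bar R) (x y w : 'cV[R]_n).

Definition edom f : set 'cV[R]_n := [set x | (f x < +oo)%E].

Definition eproper f : Prop := (forall x, (-oo < f x)%E) /\ edom f !=set0.

(* Only used together with [eproper], so that no oo - oo occurs on the right;
   0 * +oo = 0 at the endpoints. *)
Definition econvex f : Prop :=
  forall x y (t : R), 0 <= t <= 1 ->
    (f (t *: x + (1 - t) *: y)%R <= t%:E * f x + (1 - t)%R%:E * f y)%E.

(* For proper convex functions, closed means lower semicontinuous. *)
Definition closed_proper_convex f : Prop :=
  [/\ eproper f, econvex f & lower_semicontinuous f].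

(* Empty outside [edom f] as soon as f is proper. *)
Definition subdifferential f x : set 'cV[R]_n :=
  [set w | forall y, (f x + (dot w (y - x)%R)%:E <= f y)%E].

Definition argmin f : set 'cV[R]_n := [set x | forall y, (f x <= f y)%E].

Definition gradient (h : 'cV[R]_n -> R) x : 'cV[R]_n :=
  \col_i 'D_(delta_mx i 0) (h : 'cV[R]_n -> R^o) x.

(* S may be degenerate; S = 0 is plain monotonicity of the subdifferential. *)
Definition subdiff_monotone f (S : 'M[R]_n) : Prop :=
  forall x x' w w', edom f x -> edom f x' ->
    subdifferential f x w -> subdifferential f x' w' ->
    sqnorm S (x - x') <= dot (x - x') (w - w').

End ConvexAnalysis.

Section ADMM.
Context {R : realType} {m d1 d2 : nat}.

Definition quad_coupling (H11 : 'M[R]_d1) (H12 : 'M[R]_(d1, d2))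
    (H22 : 'M[R]_d2) (g1 : 'cV[R]_d1) (g2 : 'cV[R]_d2)
    (x1 : 'cV[R]_d1) (x2 : 'cV[R]_d2) : R :=
  2^-1 * dot x1 (H11 *m x1) + dot x1 (H12 *m x2) + 2^-1 * dot x2 (H22 *m x2)
  + dot g1 x1 + dot g2 x2.

Variables (theta1 : 'cV[R]_d1 -> \bar R) (theta2 : 'cV[R]_d2 -> \bar R).
Variable phi : 'cV[R]_d1 -> 'cV[R]_d2 -> R.
Variables (A1 : 'M[R]_(m, d1)) (A2 : 'M[R]_(m, d2)) (b : 'cV[R]_m).

Definition KKT (x1 : 'cV[R]_d1) (x2 : 'cV[R]_d2) (mu : 'cV[R]_m) : Prop :=
  [/\ subdifferential theta1 x1
        (- gradient (fun y1 => phi y1 x2) x1 + A1^T *m mu),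
      subdifferential theta2 x2
        (- gradient (fun y2 => phi x1 y2) x2 + A2^T *m mu)
    & A1 *m x1 + A2 *m x2 = b].

Variables (beta : R) (R1 : 'M[R]_d1) (R2 : 'M[R]_d2).

Definition prox_ADMM (x1 : nat -> 'cV[R]_d1) (x2 : nat -> 'cV[R]_d2)
    (mu : nat -> 'cV[R]_m) : Prop :=
  forall k : nat,
  [/\ argmin (fun y1 => theta1 y1 +
        (phi y1 (x2 k) - dot (mu k) (A1 *m y1)
         + beta / 2 * sqnorm 1%:M (A1 *m y1 + A2 *m x2 k - b)
         + 2^-1 * sqnorm R1 (y1 - x1 k))%R%:E)%E (x1 k.+1),
      argmin (fun y2 => theta2 y2 +
        (phi (x1 k.+1) y2 - dot (mu k) (A2 *m y2)
         + beta / 2 * sqnorm 1%:M (A1 *m x1 k.+1 + A2 *m y2 - b)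
         + 2^-1 * sqnorm R2 (y2 - x2 k))%R%:E)%E (x2 k.+1)
    & mu k.+1 = mu k - beta *: (A1 *m x1 k.+1 + A2 *m x2 k.+1 - b)].

End ADMM.

(* Main.v *)
Require Import Defs.
From HB Require Import structures.
From mathcomp Require Import all_boot all_order all_algebra.
From mathcomp Require Import all_classical all_reals all_analysis.
From mathcomp Require Import ring lra.
Import Order.TTheory GRing.Theory Num.Theory.
Import numFieldNormedType.Exports.

Set Implicit Arguments.
Unset Strict Implicit.
Unset Printing Implicit Defensive.

Local Open Scope classical_set_scope.
Local Open Scope ring_scope.

(** Fix a KKT point and let e1, e2, nu be the deviations of the iterates from
    it, a prime marking the next iterate. The whole proof rests on the energy
      V = |e1|^2_R1 + |e2|^2_R2 + |e2|^2_H22 + beta |A2 e2|^2 + |nu|^2 / beta.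

    The optimality conditions of the two subproblems
    ([argmin_subdifferential]) and the KKT conditions give elements of the
    subdifferentials of theta1 and theta2 at the iterates and at the KKT point.
    Adding up the two monotonicity inequalities shows that V drops at each step
    by at least
      D = 2 |e1'|^2_S1 + 2 |e2'|^2_S2 + |e1' - e1|^2_R1 + |e2' - e2|^2_R2
          + beta |A1 e1' + A2 e2|^2 + |(e1', e2')|^2_H + |(e1', e2)|^2_H
    ([lyapunov_decrease]). As the first subproblem sees e2 and not e2', a cross
    term <e1', H12 (e2' - e2)> appears. This is why |e2|^2_H22 is part of V: it
    turns that term into the two squares in the seminorm of H.

    The inequality V' + D <= V bounds each of the seminorms that the
    positive definiteness hypothesis adds up, so that
    |e1'|^2 + |e2'|^2 + |nu'|^2 <= c V with c a constant
    ([lyapunov_coercive]). Hence the iterates are bounded, and they converge to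
    the KKT point as soon as V tends to 0; as V is nonincreasing, it suffices
    that the iterates approach the KKT point along some filter
    ([iterates_cvg]).

    It remains to find a KKT point which the iterates approach in this weak
    sense ([exists_cluster_KKT]). Along an ultrafilter finer than the
    neighbourhoods of infinity, all bounded sequences converge at once; so
    the iterates of index k+1, k+2 and k+3 have limits a, b and c. Two
    consecutive limits satisfy D = 0, because D is summable. This does not yet
    say that the multiplier is stationary: nothing in D controls A2 (c2 - b2).
    Monotonicity of the subdifferential of theta2 between b2 and c2, in which
    all the other terms vanish, yields 0 <= - beta |A2 (c2 - b2)|^2. Therefore
    A2 c2 = A2 b2, the multipliers at b and c coincide, and the limits of the
    optimality conditions are the KKT conditions at c
    ([fixed_point_KKT]). *)

(** * Dot products and semidefinite forms *)

Section DotProduct.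
Context {R : realType}.
Implicit Types n m p : nat.

Lemma dotE n (u v : 'cV[R]_n) : dot u v = \sum_i u i 0 * v i 0.
Proof. by rewrite /dot mxE; apply: eq_bigr => i _; rewrite mxE. Qed.

Lemma dotC n (u v : 'cV[R]_n) : dot u v = dot v u.
Proof. by rewrite !dotE; apply: eq_bigr => i _; rewrite mulrC. Qed.

Lemma dotDr n (u v w : 'cV[R]_n) : dot u (v + w) = dot u v + dot u w.
Proof. by rewrite /dot mulmxDr mxE. Qed.

Lemma dotNr n (u v : 'cV[R]_n) : dot u (- v) = - dot u v.
Proof. by rewrite /dot mulmxN mxE. Qed.

Lemma dotZr n a (u v : 'cV[R]_n) : dot u (a *: v) = a * dot u v.
Proof. by rewrite /dot -scalemxAr mxE. Qed.

Lemma dotDl n (u v w : 'cV[R]_n) : dot (u + v) w = dot u w + dot v w.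
Proof. by rewrite !(dotC _ w) dotDr. Qed.

Lemma dotNl n (u v : 'cV[R]_n) : dot (- u) v = - dot u v.
Proof. by rewrite !(dotC _ v) dotNr. Qed.

Lemma dotZl n a (u v : 'cV[R]_n) : dot (a *: u) v = a * dot u v.
Proof. by rewrite !(dotC _ v) dotZr. Qed.

Definition dot_linE := (dotDl, dotDr, dotNl, dotNr, dotZl, dotZr).

Lemma mulmxZr n m p a (A : 'M[R]_(m, n)) (B : 'M[R]_(n, p)) :
  A *m (a *: B) = a *: (A *m B).
Proof. by rewrite scalemxAr. Qed.

Definition bilinE := (mulmxDr, mulmxN, mulmxZr, dot_linE).

Lemma dot_trmx m n (A : 'M[R]_(m, n)) u v : dot u (A^T *m v) = dot (A *m u) v.
Proof. by rewrite /dot trmx_mul mulmxA. Qed.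

Lemma dot_sym n (G : 'M[R]_n) u v : G^T = G -> dot u (G *m v) = dot v (G *m u).
Proof. by move=> GT; rewrite -{1}GT dot_trmx dotC. Qed.

Lemma dot0l n (v : 'cV[R]_n) : dot 0 v = 0.
Proof. by rewrite -(scale0r 0) dotZl mul0r. Qed.

Lemma dot_deltal n (i : 'I_n) (v : 'cV[R]_n) : dot (delta_mx i 0) v = v i 0.
Proof.
rewrite dotE (bigD1 i) //= mxE !eqxx mul1r big1 ?addr0 // => j ji.
by rewrite mxE (negbTE ji) mul0r.
Qed.

Lemma sqnorm1E n (v : 'cV[R]_n) : sqnorm 1%:M v = dot v v.
Proof. by rewrite /sqnorm mul1mx. Qed.

Lemma dotvv_ge0 n (v : 'cV[R]_n) : 0 <= dot v v.
Proof. by rewrite dotE sumr_ge0 // => i _; rewrite -expr2 sqr_ge0. Qed.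

Lemma sqr_entry_le n (v : 'cV[R]_n) i : v i 0 ^+ 2 <= dot v v.
Proof.
rewrite dotE (bigD1 i) //= -expr2 lerDl sumr_ge0 // => j _.
by rewrite -expr2 sqr_ge0.
Qed.

Lemma dotvv_eq0 n (v : 'cV[R]_n) : dot v v = 0 -> v = 0.
Proof.
move=> v0; apply/colP => i; rewrite mxE; apply/eqP.
by rewrite -sqrf_eq0 eq_le sqr_ge0 andbT -v0 sqr_entry_le.
Qed.

End DotProduct.

Section Semidefinite.
Context {R : realType}.

(** The quadratic polynomial t |-> |u + t v|^2_G is nonnegative, so its
    discriminant is not positive. *)
Lemma psd_CauchySchwarz n (G : 'M[R]_n) u v : psd G ->
  dot u (G *m v) ^+ 2 <= sqnorm G u * sqnorm G v.
Proof.
case=> GT G0.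
have q (t : R) : 0 <= sqnorm G u + 2 * t * dot u (G *m v) + t ^+ 2 * sqnorm G v.
  have := G0 (u + t *: v); rewrite /sqnorm !bilinE (dot_sym v u GT).
  by move=> h; apply: le_trans h _; rewrite le_eqVlt; apply/predU1P; left; ring.
set b := dot u _ in q *; set a := sqnorm G u in q *; set c := sqnorm G v in q *.
have [c0|c0] := eqVneq c 0.
  (* a linear polynomial which is nonnegative everywhere is constant *)
  have [->|b0] := eqVneq b 0; first by rewrite expr0n /= c0 mulr0.
  have := q (- (a + 1) / (2 * b)); rewrite c0 mulr0 addr0.
  have -> : a + 2 * (- (a + 1) / (2 * b)) * b = -1 by field.
  by lra.
have cgt0 : 0 < c by rewrite lt_neqAle eq_sym c0 /=; exact: G0.
(* the minimizer of the polynomial *)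
have := q (- b / c).
have -> : a + 2 * (- b / c) * b + (- b / c) ^+ 2 * c = (a * c - b ^+ 2) / c.
  by field.
by rewrite pmulr_lge0 ?invr_gt0 // subr_ge0.
Qed.

Lemma psd_sqnorm_eq0 n (G : 'M[R]_n) v : psd G -> sqnorm G v = 0 -> G *m v = 0.
Proof.
move=> Gp v0; apply: dotvv_eq0; apply/eqP.
rewrite -sqrf_eq0 eq_le sqr_ge0 andbT.
by rewrite (le_trans (psd_CauchySchwarz (G *m v) v Gp)) // v0 mulr0.
Qed.

Lemma sqnormD_le n (G : 'M[R]_n) u v : psd G ->
  sqnorm G (u + v) <= 2 * sqnorm G u + 2 * sqnorm G v.
Proof.
case=> GT G0; have := G0 (u - v).
rewrite /sqnorm !bilinE (dot_sym v u GT); lra.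
Qed.

Lemma dot_mulmx_le m n (A : 'M[R]_(m, n)) :
  exists2 c : R, 0 <= c & forall v, dot (A *m v) (A *m v) <= c * dot v v.
Proof.
pose rows i := (row i A)^T.
have AE i v : (A *m v) i 0 = dot (rows i) v.
  by rewrite /dot /rows trmxK -row_mul [RHS]mxE.
exists (\sum_i dot (rows i) (rows i)).
  by apply: sumr_ge0 => i _; exact: dotvv_ge0.
move=> v; rewrite [leLHS]dotE mulr_suml ler_sum // => i _.
have := @psd_CauchySchwarz n 1%:M (rows i) v.
rewrite -expr2 AE !sqnorm1E mul1mx; apply; split; first by rewrite trmx1.
by move=> w; rewrite sqnorm1E dotvv_ge0.
Qed.

(** Norm equivalence without compactness: v is the image of G v under the
    inverse of G, and Cauchy-Schwarz bounds the entries of G v by |v|_G. *)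
Lemma posdef_coercive n (G : 'M[R]_n) : posdef G ->
  exists2 c : R, 0 <= c & forall v, dot v v <= c * sqnorm G v.
Proof.
case=> GT Gpos.
have Gp : psd G.
  split=> // v; have [->|/Gpos/ltW//] := eqVneq v 0.
  by rewrite /sqnorm dot0l.
have Gu : G \in unitmx.
  rewrite -row_free_unit; apply: inj_row_free => v vG.
  apply: trmx_inj; rewrite trmx0; apply/eqP; apply: contraT => /Gpos.
  by rewrite /sqnorm -[X in X *m _]GT -trmx_mul vG trmx0 dotC dot0l ltxx.
have [c c0 cP] := dot_mulmx_le (invmx G).
pose s := \sum_i sqnorm G (delta_mx i 0).
have s0 : 0 <= s by apply: sumr_ge0 => i _; exact: Gp.2.
exists (c * s); first exact: mulr_ge0.
move=> v; have := cP (G *m v); rewrite mulKmx // => h.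
apply: le_trans h _.
rewrite -mulrA ler_wpM2l // [leLHS]dotE mulr_suml ler_sum // => i _.
by rewrite -expr2 -dot_deltal psd_CauchySchwarz.
Qed.

End Semidefinite.

(** * Limits of vectors *)

Section VectorLimits.
Context {R : realType} {T : Type} {F : set_system T} {FF : Filter F}.

Lemma cvg_colP n (u : T -> 'cV[R]_n) (l : 'cV[R]_n) :
  (forall i, u k i 0 @[k --> F] --> l i 0) -> u k @[k --> F] --> l.
Proof.
move=> ul; apply/cvg_ballP => e e0.
have : \forall k \near F, forall i, ball (l i 0) e (u k i 0).
  by apply: filter_forall => i; have /cvg_ballP/(_ _ e0) := ul i.
by apply: filterS => k h; split=> // i j; rewrite (ord1 j).
Qed.

Lemma cvg_entry n (u : T -> 'cV[R]_n) (l : 'cV[R]_n) i :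
  u k @[k --> F] --> l -> u k i 0 @[k --> F] --> l i 0.
Proof. by move=> ul; exact: (cvg_comp _ _ ul (@coord_continuous R n 1 i 0 l)). Qed.

Lemma cvg_dot n (u v : T -> 'cV[R]_n) (a b : 'cV[R]_n) :
  u k @[k --> F] --> a -> v k @[k --> F] --> b ->
  dot (u k) (v k) @[k --> F] --> dot a b.
Proof.
move=> ua vb; rewrite dotE; under eq_fun do rewrite dotE.
by apply: cvg_big => [|i _]; [exact: add_continuous|apply: cvgM]; exact: cvg_entry.
Qed.

Lemma cvg_mulmx m n (A : 'M[R]_(m, n)) (u : T -> 'cV[R]_n) (a : 'cV[R]_n) :
  u k @[k --> F] --> a -> A *m u k @[k --> F] --> A *m a.
Proof.
move=> ua; apply: cvg_colP => i; rewrite mxE; under eq_fun do rewrite mxE.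
apply: cvg_big => [|j _]; first exact: add_continuous.
by apply: cvgM; [exact: cvg_cst|exact: cvg_entry].
Qed.

Lemma cvg_sqnorm n (G : 'M[R]_n) (u : T -> 'cV[R]_n) (a : 'cV[R]_n) :
  u k @[k --> F] --> a -> sqnorm G (u k) @[k --> F] --> sqnorm G a.
Proof. by move=> ua; apply: cvg_dot => //; exact: cvg_mulmx. Qed.

Lemma cvg_col_mx n p (u : T -> 'cV[R]_n) (v : T -> 'cV[R]_p)
    (a : 'cV[R]_n) (b : 'cV[R]_p) :
  u k @[k --> F] --> a -> v k @[k --> F] --> b ->
  col_mx (u k) (v k) @[k --> F] --> col_mx a b.
Proof.
move=> ua vb; apply: cvg_colP => i; rewrite mxE; under eq_fun do rewrite mxE.
by case: (fintype.split i) => j; exact: cvg_entry.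
Qed.

Lemma cvg_dot0 n (u : T -> 'cV[R]_n) (a : 'cV[R]_n) :
  dot (u k - a) (u k - a) @[k --> F] --> (0 : R) -> u k @[k --> F] --> a.
Proof.
move=> h; apply: cvg_colP => i; apply/cvgrPdist_lt => e e0.
have e20 : 0 < e ^+ 2 by rewrite exprn_gt0.
apply: filterS (cvgr0_norm_lt _ h _ e20) => k.
rewrite ger0_norm ?dotvv_ge0 // => hk.
rewrite -(ltr_pXn2r (n := 2)) ?nnegrE ?normr_ge0 ?(ltW e0) //.
rewrite distrC real_normK ?num_real //; apply: le_lt_trans hk.
by have := sqr_entry_le (u k - a) i; rewrite !mxE.
Qed.

End VectorLimits.

Arguments cvg_dot {R T F FF n u v a b}.
Arguments cvg_mulmx {R T F FF m n} A {u a}.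
Arguments cvg_sqnorm {R T F FF n} G {u a}.
Arguments cvg_col_mx {R T F FF n p u v a b}.

Section Ultra.
Context {R : realType} (U : set_system nat) {UU : UltraFilter U}.

(** Bolzano-Weierstrass without extraction of subsequences: a single ultrafilter
    makes every bounded sequence converge, so that limits of several shifted
    sequences are available simultaneously. *)
Lemma ultra_bounded_cvg n (u : nat -> 'cV[R]_n) (M : R) :
  (forall k, dot (u k) (u k) <= M) -> exists l : 'cV[R]_n, u k @[k --> U] --> l.
Proof.
move=> uM.
have cvg_real (r : nat -> R) : (forall k, r k ^+ 2 <= M) ->
    exists l : R, r k @[k --> U] --> l.
  move=> rM; have : compact `[- (1 + M), 1 + M] by exact: segment_compact.
  case/(_ (r @ U) _ _).
    suff rI k : r k \in `[- (1 + M), 1 + M] by apply: (filterE (F := U)) => k /=.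
    rewrite in_itv /= -ler_norml.
    have := rM k; rewrite -real_normK ?num_real //.
    have := normr_ge0 (r k); have := sqr_ge0 (`|r k| - 1); nra.
  (* a cluster point of an ultrafilter is a limit *)
  move=> l [_ lP]; exists l => A lA.
  have [//|UnA] := in_ultra_setVsetC (r @^-1` A) UU.
  by have [y []] := lP (~` A) A UnA lA.
have /choice[l lP] : forall i, exists l : R, u k i 0 @[k --> U] --> l.
  by move=> i; apply: cvg_real => k; exact: le_trans (sqr_entry_le _ _) (uM k).
by exists (\col_i l i); apply: cvg_colP => i; rewrite mxE.
Qed.

End Ultra.

Section ScalarSequences.
Context {R : realType}.

Lemma nonincreasing_gap_cvg0 (V D : nat -> R) : (forall k, 0 <= V k) ->
  (forall k, 0 <= D k) -> (forall k, V k.+1 + D k <= V k) ->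
  D k @[k --> \oo] --> (0 : R).
Proof.
move=> V0 D0 VD.
have Vc : cvgn V.
  apply: nonincreasing_is_cvgn; last by exists 0 => _ [k _ <-]; exact: V0.
  by apply/nonincreasing_seqP => k; have := VD k; have := D0 k; lra.
have gap : V k - V k.+1 @[k --> \oo] --> (0 : R).
  rewrite -(subrr (limn V)); apply: cvgB; first exact: Vc.
  by rewrite (@cvg_shiftS R V).
apply: (squeeze_cvgr _ (cvg_cst 0) gap); apply: nearW => k.
by rewrite D0 /=; have := VD k; lra.
Qed.

(** A proper filter provides one term below a given bound, and this term bounds
    all the later ones. *)
Lemma nonincreasing_cvg0 (F : set_system nat) {FF : ProperFilter F} (V : nat -> R) :
  (forall k, 0 <= V k) -> (forall k, V k.+1 <= V k) ->
  V k @[k --> F] --> (0 : R) -> V k @[k --> \oo] --> (0 : R).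
Proof.
move=> V0 VS VF; apply/cvgrPdist_lt => e e0.
have [N VN] := filter_ex (cvgr0_norm_lt _ VF _ e0).
exists N => // k /= Nk; rewrite sub0r normrN; apply: le_lt_trans VN.
rewrite !ger0_norm //; elim: k Nk => [|k IHk]; first by rewrite leqn0 => /eqP ->.
rewrite leq_eqVlt => /predU1P[->//|]; rewrite ltnS => /IHk.
exact: le_trans.
Qed.

End ScalarSequences.

(** * Subdifferentials of convex functions *)

Section Convex.
Context {R : realType} {n : nat}.
Implicit Types (f : 'cV[R]_n -> \bar R) (q : 'cV[R]_n -> R) (x g : 'cV[R]_n).

(** Exact second-order expansion at x with gradient g. All smooth terms of the
    iteration are of this form, and it yields both the gradient in the KKT
    system and the first-order condition for the subproblems. *)
Definition quadratic_at q x g := exists C : 'cV[R]_n -> R,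
  forall v t, q (x + t *: v) = q x + t * dot g v + t ^+ 2 * C v.

Lemma quadratic_at_gradient q x g : quadratic_at q x g -> gradient q x = g.
Proof.
case=> C qE; apply/colP => i; rewrite mxE /derive.
apply: cvg_lim => //.
have L : g i 0 + t * C (delta_mx i 0) @[t --> 0^'] --> g i 0 + 0 * C (delta_mx i 0).
  apply: cvgD; first exact: cvg_cst.
  by apply: cvgMl; apply: cvg_within.
rewrite mul0r addr0 in L; apply: cvg_trans L.
apply: near_eq_cvg; near=> t.
have t0 : t != 0 by near: t; exact: nbhs_dnbhs_neq.
rewrite /= [_ *: _ + x]addrC qE (dotC g) dot_deltal /GRing.scale /=; by field.
Unshelve. all: by end_near. Qed.

(** Compare x with points of the segment from x to y: convexity of f makes the
    change of f linear in the step t, whereas q has a linear part, given by g,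
    and a part of order t^2. Divide by t and let t tend to 0. *)
Lemma argmin_subdifferential f q x g : eproper f -> econvex f ->
  quadratic_at q x g -> argmin (fun y => f y + (q y)%:E)%E x ->
  subdifferential f x (- g).
Proof.
move=> [fp [y0 fy0]] fc [C qE] xmin.
have [a fx] : exists a, f x = a%:E.
  have := xmin y0; have := fp x; move: fy0; rewrite /edom /=; have := fp y0.
  by case: (f y0) => [c||] // _ _; case: (f x) => [a||] //= _; exists a.
move=> y; have := fp y; case fy: (f y) => [c||] // _; last by rewrite leey.
rewrite fx -EFinD lee_fin dotNl.
have {xmin} h t : 0 < t -> t <= 1 ->
    0 <= (c - a + dot g (y - x)) + t * C (y - x).
  move=> t0 t1.
  have := xmin (x + t *: (y - x)); rewrite qE.
  have xE : x + t *: (y - x) = t *: y + (1 - t) *: x.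
    by rewrite scalerBr scalerBl scale1r addrCA addrA.
  have t01 : 0 <= t <= 1 by rewrite (ltW t0).
  have := fc y x t t01; rewrite -xE fx fy.
  have := fp (x + t *: (y - x)); case: (f _) => [e||] // _.
  rewrite -!EFinM -!EFinD !lee_fin => h1 h2.
  have : 0 <= t * ((c - a + dot g (y - x)) + t * C (y - x)) by lra.
  by rewrite pmulr_rge0.
rewrite -subr_ge0; set s := (X in 0 <= X).
have {}h t : 0 < t -> t <= 1 -> 0 <= s + t * C (y - x).
  by move=> t0 t1; have := h t t0 t1; rewrite /s; lra.
(* a negative constant term would dominate for small t *)
rewrite leNgt; apply/negP => s0.
set D := C _ in h; have D0 : 0 < 1 - s + `|D| by have := normr_ge0 D; lra.
have tD : - s / (1 - s + `|D|) * (1 - s + `|D|) = - s by rewrite mulfVK ?gt_eqF.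
set t := - s / _ in tD.
have t0 : 0 < t by rewrite divr_gt0 // oppr_gt0.
have t1 : t <= 1 by rewrite ler_pdivrMr // mul1r; have := normr_ge0 D; lra.
have tDle : t * D <= t * `|D| by rewrite ler_wpM2l ?(ltW t0) ?ler_norm.
have ts : 0 < t * (1 - s) by rewrite mulr_gt0 //; lra.
have {h} := h t t0 t1; clear fx fy fp fc; lra.
Qed.

Lemma subdifferential_edom f x w : eproper f -> subdifferential f x w -> edom f x.
Proof.
move=> [_ [y]] + /(_ y); rewrite /edom /=.
case: (f x) => [a _ _||]; [exact: ltry| |by []].
by case: (f y).
Qed.

(** If the inequality failed in the limit at y, some real a would lie strictly
    between f y - <g, y - x> and f x; lower semicontinuity gives a < f (u k)
    eventually, hence a < f y - <w k, y - u k>, whose limit contradicts the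
    choice of a. *)
Lemma subdifferential_closed (T : Type) (F : set_system T) {FF : ProperFilter F}
    f (u w : T -> 'cV[R]_n) x g : (forall y, (-oo < f y)%E) ->
  lower_semicontinuous f ->
  (forall k, subdifferential f (u k) (w k)) ->
  u k @[k --> F] --> x -> w k @[k --> F] --> g -> subdifferential f x g.
Proof.
move=> fp fl fuw ux wg y; have := fp y.
case fy: (f y) => [c||] // _; last by rewrite leey.
rewrite -leeBrDr // -EFinB leNgt; apply/negP => h.
have [a /andP[ca afx]] : exists a, (c - dot g (y - x) < a)%R && (a%:E < f x)%E.
  move: h; case: (f x) => [b||] //=.
    by rewrite lte_fin => h; exists ((c - dot g (y - x) + b) / 2); rewrite lte_fin; lra.
  by move=> _; exists (c - dot g (y - x) + 1); rewrite ltry; lra.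
have [V Vx Va] := fl _ _ afx.
suff : a <= c - dot g (y - x) by lra.
have lim_c : c - dot (w k) (y - u k) @[k --> F] --> c - dot g (y - x).
  apply: cvgB; first exact: cvg_cst.
  by apply: cvg_dot => //; apply: cvgB => //; exact: cvg_cst.
rewrite -(cvg_lim _ lim_c) //; apply: limr_ge; first by apply/cvg_ex; eexists; exact: lim_c.
apply: (filterS (F := F) _ (ux _ Vx)) => k /= /Va afu.
have := fuw k y; rewrite fy; move: afu; case: (f (u k)) => [b||] //.
by rewrite lte_fin -EFinD lee_fin; lra.
Qed.

End Convex.

(** * Block matrices *)

Section Blocks.
Context {R : realType} {d1 d2 : nat}.
Implicit Types (M : 'M[R]_d1) (N : 'M[R]_d2) (B : 'M[R]_(d1, d2)).

Lemma sqnorm_block M B (C : 'M[R]_(d2, d1)) N u1 u2 :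
  sqnorm (block_mx M B C N) (col_mx u1 u2) =
  dot u1 (M *m u1 + B *m u2) + dot u2 (C *m u1 + N *m u2).
Proof. by rewrite /sqnorm mul_block_col /dot tr_col_mx mul_row_col mxE. Qed.

Lemma posdef_blocks M B (C : 'M[R]_(d2, d1)) N :
  posdef (block_mx M B C N) -> posdef M /\ posdef N.
Proof.
case; rewrite tr_block_mx => /eq_block_mx[MT _ _ NT] pos; split; split=> // v v0.
  have := pos (col_mx v 0); rewrite sqnorm_block !mulmx0 dot0l !addr0 => -> //.
  by rewrite col_mx_eq0 negb_and v0.
have := pos (col_mx 0 v); rewrite sqnorm_block !mulmx0 dot0l !add0r => -> //.
by rewrite col_mx_eq0 negb_and v0 orbT.
Qed.

Lemma psd_blocks M B (C : 'M[R]_(d2, d1)) N :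
  psd (block_mx M B C N) -> psd M /\ psd N.
Proof.
case; rewrite tr_block_mx => /eq_block_mx[MT _ _ NT] pos; split; split=> // v.
  by have := pos (col_mx v 0); rewrite sqnorm_block !mulmx0 dot0l !addr0.
by have := pos (col_mx 0 v); rewrite sqnorm_block !mulmx0 dot0l !add0r.
Qed.

End Blocks.

(** * The energy of the two-block proximal iteration *)

Section ProximalADMM.
Context {R : realType} {m d1 d2 : nat}.
Variables (A1 : 'M[R]_(m, d1)) (A2 : 'M[R]_(m, d2)) (b : 'cV[R]_m).
Variables (g1 : 'cV[R]_d1) (g2 : 'cV[R]_d2).
Variables (H11 : 'M[R]_d1) (H12 : 'M[R]_(d1, d2)) (H22 : 'M[R]_d2).
Variables (S1 : 'M[R]_d1) (S2 : 'M[R]_d2) (beta : R).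
Variables (R1 : 'M[R]_d1) (R2 : 'M[R]_d2).
Hypothesis H_psd : psd (block_mx H11 H12 H12^T H22).
Hypotheses (S1_psd : psd S1) (S2_psd : psd S2) (beta_gt0 : 0 < beta).
Hypotheses (R1_psd : psd R1) (R2_psd : psd R2).

Let H11_psd : psd H11. Proof. exact: (psd_blocks H_psd).1. Qed.
Let H22_psd : psd H22. Proof. exact: (psd_blocks H_psd).2. Qed.

Local Notation phi := (quad_coupling H11 H12 H22 g1 g2).

Definition phi_grad1 x1 x2 : 'cV[R]_d1 := H11 *m x1 + H12 *m x2 + g1.
Definition phi_grad2 x1 x2 : 'cV[R]_d2 := H12^T *m x1 + H22 *m x2 + g2.

Lemma quadratic_at_phi1 x1 x2 :
  quadratic_at (fun y => phi y x2) x1 (phi_grad1 x1 x2).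
Proof.
exists (fun v => 2^-1 * sqnorm H11 v) => v t.
rewrite /quad_coupling /phi_grad1 /sqnorm !bilinE !(dotC _ v).
by rewrite (dot_sym x1 v H11_psd.1); field.
Qed.

Lemma quadratic_at_phi2 x1 x2 :
  quadratic_at (fun y => phi x1 y) x2 (phi_grad2 x1 x2).
Proof.
exists (fun v => 2^-1 * sqnorm H22 v) => v t.
rewrite /quad_coupling /phi_grad2 /sqnorm !bilinE !(dotC _ v) dot_trmx.
by rewrite (dot_sym x2 v H22_psd.1) (dotC (H12 *m v)); field.
Qed.

(** Gradients at the new iterate of the smooth parts of the two subproblems. *)
Definition prox_grad1 (x1 x1' : 'cV[R]_d1) (x2 : 'cV[R]_d2) (mu : 'cV[R]_m) :=
  phi_grad1 x1' x2 - A1^T *m mu + beta *: (A1^T *m (A1 *m x1' + A2 *m x2 - b))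
  + R1 *m (x1' - x1).

Definition prox_grad2 (x1' : 'cV[R]_d1) (x2 x2' : 'cV[R]_d2) (mu : 'cV[R]_m) :=
  phi_grad2 x1' x2' - A2^T *m mu + beta *: (A2^T *m (A1 *m x1' + A2 *m x2' - b))
  + R2 *m (x2' - x2).

Lemma quadratic_at_prox1 x1 x1' x2 mu : quadratic_at (fun y1 =>
    phi y1 x2 - dot mu (A1 *m y1)
    + beta / 2 * sqnorm 1%:M (A1 *m y1 + A2 *m x2 - b)
    + 2^-1 * sqnorm R1 (y1 - x1)) x1' (prox_grad1 x1 x1' x2 mu).
Proof.
have [C CE] := quadratic_at_phi1 x1' x2.
exists (fun v => C v + beta / 2 * dot (A1 *m v) (A1 *m v) + 2^-1 * sqnorm R1 v).
move=> v t; rewrite CE {CE} /prox_grad1 !sqnorm1E /sqnorm.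
move: (phi_grad1 x1' x2) => g.
have -> : A1 *m (x1' + t *: v) + A2 *m x2 - b
    = (A1 *m x1' + A2 *m x2 - b) + t *: (A1 *m v).
  by rewrite mulmxDr mulmxZr -!addrA; congr (_ + _); rewrite addrC !addrA.
have -> : x1' + t *: v - x1 = (x1' - x1) + t *: v by rewrite addrAC.
move: (A1 *m x1' + A2 *m x2 - b) (x1' - x1) => r D.
rewrite !bilinE !(dotC _ v) !dot_trmx (dot_sym D v R1_psd.1).
by rewrite (dotC r) (dotC mu) (dotC mu); field.
Qed.

Lemma quadratic_at_prox2 x1' x2 x2' mu : quadratic_at (fun y2 =>
    phi x1' y2 - dot mu (A2 *m y2)
    + beta / 2 * sqnorm 1%:M (A1 *m x1' + A2 *m y2 - b)
    + 2^-1 * sqnorm R2 (y2 - x2)) x2' (prox_grad2 x1' x2 x2' mu).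
Proof.
have [C CE] := quadratic_at_phi2 x1' x2'.
exists (fun v => C v + beta / 2 * dot (A2 *m v) (A2 *m v) + 2^-1 * sqnorm R2 v).
move=> v t; rewrite CE {CE} /prox_grad2 !sqnorm1E /sqnorm.
move: (phi_grad2 x1' x2') => g.
have -> : A1 *m x1' + A2 *m (x2' + t *: v) - b
    = (A1 *m x1' + A2 *m x2' - b) + t *: (A2 *m v).
  by rewrite mulmxDr mulmxZr !addrA [LHS]addrAC.
have -> : x2' + t *: v - x2 = (x2' - x2) + t *: v by rewrite addrAC.
move: (A1 *m x1' + A2 *m x2' - b) (x2' - x2) => r D.
rewrite !bilinE !(dotC _ v) !dot_trmx (dot_sym D v R2_psd.1).
by rewrite (dotC r) (dotC mu) (dotC mu); field.
Qed.

(** The square seminorm of e2 for H22 compensates for the two subproblems being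
    solved one after the other: the first one sees the old value of e2. *)
Definition lyapunov (e1 : 'cV[R]_d1) (e2 : 'cV[R]_d2) (nu : 'cV[R]_m) : R :=
  sqnorm R1 e1 + sqnorm R2 e2 + sqnorm H22 e2
  + beta * dot (A2 *m e2) (A2 *m e2) + beta^-1 * dot nu nu.

(** The terms are chosen so that, together with those of the energy, they
    dominate every summand of the positive definiteness hypothesis. *)
Definition decrease (e1 e1' : 'cV[R]_d1) (e2 e2' : 'cV[R]_d2) : R :=
  2 * sqnorm S1 e1' + 2 * sqnorm S2 e2'
  + sqnorm R1 (e1' - e1) + sqnorm R2 (e2' - e2)
  + beta * dot (A1 *m e1' + A2 *m e2) (A1 *m e1' + A2 *m e2)
  + sqnorm (block_mx H11 H12 H12^T H22) (col_mx e1' e2')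
  + sqnorm (block_mx H11 H12 H12^T H22) (col_mx e1' e2).

(** The sum of the two hypotheses is rearranged by three identities, where
    D2 = e2' - e2:
    - 2 <e', R (e' - e)> = |e'|^2_R - |e|^2_R + |e' - e|^2_R for both proximal
      terms;
    - 2 (|(e1', e2')|^2_H - <e1', H12 D2>) = |(e1', e2')|^2_H
      + |(e1', e2)|^2_H + |e2'|^2_H22 - |e2|^2_H22 for the coupling;
    - the terms in A2 D2 and nu' - nu complete the square
      beta |A1 e1' + A2 e2|^2. *)
Lemma lyapunov_decrease e1 e1' e2 e2' nu nu' :
  sqnorm S1 e1' <= dot e1' (- (H11 *m e1' + H12 *m e2 - A1^T *m nu
    + beta *: (A1^T *m (A1 *m e1' + A2 *m e2)) + R1 *m (e1' - e1))) ->
  sqnorm S2 e2' <= dot e2' (- (H12^T *m e1' + H22 *m e2' - A2^T *m nu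
    + beta *: (A2^T *m (A1 *m e1' + A2 *m e2')) + R2 *m (e2' - e2))) ->
  nu' = nu - beta *: (A1 *m e1' + A2 *m e2') ->
  lyapunov e1' e2' nu' + decrease e1 e1' e2 e2' <= lyapunov e1 e2 nu.
Proof.
move=> i1 i2 ->; rewrite /lyapunov /decrease.
have -> (r : 'cV_m) : beta^-1 * dot (nu - beta *: r) (nu - beta *: r)
    = beta^-1 * dot nu nu - 2 * dot nu r + beta * dot r r.
  by rewrite !bilinE (dotC r nu); field; rewrite gt_eqF.
rewrite !sqnorm_block.
move: i1 i2; move: (sqnorm S1 _) (sqnorm S2 _) => s1 s2; rewrite /sqnorm.
rewrite !bilinE !dot_trmx !(dotC _ nu) (dotC (H12 *m e2') e1') (dotC (H12 *m e2) e1').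
rewrite !(dotC (A2 *m e2') (A1 *m e1')) !(dotC (A2 *m e2) (A1 *m e1')).
rewrite (dot_sym e1 e1' R1_psd.1) (dot_sym e2 e2' R2_psd.1).
lra.
Qed.


Lemma sqnorm_augment (d : nat) (H S R0 : 'M[R]_d) (A : 'M[R]_(m, d)) e :
  sqnorm (H + S + A^T *m A + R0) e =
  sqnorm H e + sqnorm S e + dot (A *m e) (A *m e) + sqnorm R0 e.
Proof. by rewrite /sqnorm !mulmxDl !dotDr -mulmxA dot_trmx. Qed.

(** The multiplier update is such that the second subproblem leaves the new
    multiplier in its optimality condition; only R2 is left as a
    perturbation of the second KKT inclusion. *)
Lemma prox_grad2E x1' x2 x2' (mu mu' : 'cV[R]_m) :
  mu' = mu - beta *: (A1 *m x1' + A2 *m x2' - b) ->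
  prox_grad2 x1' x2 x2' mu = phi_grad2 x1' x2' - A2^T *m mu' + R2 *m (x2' - x2).
Proof.
by move=> ->; rewrite mulmxBr mulmxZr; congr (_ + _); rewrite opprB addrA addrAC.
Qed.

Lemma lyapunov_ge0 e1 e2 nu : 0 <= lyapunov e1 e2 nu.
Proof.
have [b0 b1] : 0 <= beta /\ 0 <= beta^-1 by rewrite invr_ge0 ltW.
by rewrite !addr_ge0 ?mulr_ge0 ?dotvv_ge0 ?R1_psd.2 ?R2_psd.2 ?H22_psd.2.
Qed.

Lemma cvg_lyapunov (T : Type) (F : set_system T) {FF : Filter F}
    (u1 : T -> 'cV[R]_d1) (u2 : T -> 'cV[R]_d2) (v : T -> 'cV[R]_m) e1 e2 nu :
  u1 k @[k --> F] --> e1 -> u2 k @[k --> F] --> e2 -> v k @[k --> F] --> nu ->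
  lyapunov (u1 k) (u2 k) (v k) @[k --> F] --> lyapunov e1 e2 nu.
Proof.
move=> u1F u2F vF; have c0 (c : R) : cst c k @[k --> F] --> c by exact: cvg_cst.
exact: (cvgD (cvgD (cvgD (cvgD (cvg_sqnorm R1 u1F) (cvg_sqnorm R2 u2F))
  (cvg_sqnorm H22 u2F))
  (cvgM (c0 _) (cvg_dot (cvg_mulmx A2 u2F) (cvg_mulmx A2 u2F))))
  (cvgM (c0 _) (cvg_dot vF vF))).
Qed.

Lemma cvg_decrease (T : Type) (F : set_system T) {FF : Filter F}
    (u1 u1' : T -> 'cV[R]_d1) (u2 u2' : T -> 'cV[R]_d2) e1 e1' e2 e2' :
  u1 k @[k --> F] --> e1 -> u1' k @[k --> F] --> e1' ->
  u2 k @[k --> F] --> e2 -> u2' k @[k --> F] --> e2' ->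
  decrease (u1 k) (u1' k) (u2 k) (u2' k) @[k --> F] --> decrease e1 e1' e2 e2'.
Proof.
move=> uF uF' vF vF'; have c0 (c : R) : cst c k @[k --> F] --> c by exact: cvg_cst.
have AF : A1 *m u1' k + A2 *m u2 k @[k --> F] --> A1 *m e1' + A2 *m e2.
  exact: (cvgD (cvg_mulmx A1 uF') (cvg_mulmx A2 vF)).
exact: (cvgD (cvgD (cvgD (cvgD (cvgD (cvgD
  (cvgM (c0 _) (cvg_sqnorm S1 uF')) (cvgM (c0 _) (cvg_sqnorm S2 vF')))
  (cvg_sqnorm R1 (cvgB uF' uF))) (cvg_sqnorm R2 (cvgB vF' vF)))
  (cvgM (c0 _) (cvg_dot AF AF)))
  (cvg_sqnorm _ (cvg_col_mx uF' vF'))) (cvg_sqnorm _ (cvg_col_mx uF' vF))).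
Qed.

Lemma cvg_prox_grad1 (T : Type) (F : set_system T) {FF : Filter F}
    (u1 u1' : T -> 'cV[R]_d1) (u2 : T -> 'cV[R]_d2) (v : T -> 'cV[R]_m)
    e1 e1' e2 nu :
  u1 k @[k --> F] --> e1 -> u1' k @[k --> F] --> e1' ->
  u2 k @[k --> F] --> e2 -> v k @[k --> F] --> nu ->
  - prox_grad1 (u1 k) (u1' k) (u2 k) (v k) @[k --> F]
    --> - prox_grad1 e1 e1' e2 nu.
Proof.
move=> uF uF' u2F vF; apply: cvgN.
exact: (cvgD (cvgD (cvgB (cvgD (cvgD (cvg_mulmx H11 uF') (cvg_mulmx H12 u2F))
  (cvg_cst g1)) (cvg_mulmx A1^T vF)) (cvgZr (cvg_mulmx A1^T (cvgB
  (cvgD (cvg_mulmx A1 uF') (cvg_mulmx A2 u2F)) (cvg_cst b)))))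
  (cvg_mulmx R1 (cvgB uF' uF))).
Qed.

Lemma cvg_prox_grad2 (T : Type) (F : set_system T) {FF : Filter F}
    (u1' : T -> 'cV[R]_d1) (u2 u2' : T -> 'cV[R]_d2) (v : T -> 'cV[R]_m)
    e1' e2 e2' nu :
  u1' k @[k --> F] --> e1' -> u2 k @[k --> F] --> e2 ->
  u2' k @[k --> F] --> e2' -> v k @[k --> F] --> nu ->
  - prox_grad2 (u1' k) (u2 k) (u2' k) (v k) @[k --> F]
    --> - prox_grad2 e1' e2 e2' nu.
Proof.
move=> u1F uF uF' vF; apply: cvgN.
exact: (cvgD (cvgD (cvgB (cvgD (cvgD (cvg_mulmx H12^T u1F) (cvg_mulmx H22 uF'))
  (cvg_cst g2)) (cvg_mulmx A2^T vF)) (cvgZr (cvg_mulmx A2^T (cvgB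
  (cvgD (cvg_mulmx A1 u1F) (cvg_mulmx A2 uF')) (cvg_cst b)))))
  (cvg_mulmx R2 (cvgB uF' uF))).
Qed.

Lemma decrease_ge0 e1 e1' e2 e2' : 0 <= decrease e1 e1' e2 e2'.
Proof.
by rewrite !addr_ge0 ?mulr_ge0 ?dotvv_ge0 ?S1_psd.2 ?S2_psd.2 ?R1_psd.2
  ?R2_psd.2 ?H_psd.2 // ltW.
Qed.

(** H11 and A1 act on e1' only through the mixed terms of D. They are isolated
    by the parallelogram bound, from (e1', 0) = (e1', e2') - (0, e2') and
    A1 e1' = (A1 e1' + A2 e2) - A2 e2, where the second parts are controlled by
    the energies. This makes the bound available for e1' although V contains
    neither |e1|^2_H11 nor |A1 e1|^2. *)
Lemma lyapunov_coercive :
  posdef (block_mx H11 0 0 H22 + block_mx S1 0 0 S2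
    + block_mx (A1^T *m A1) 0 0 (A2^T *m A2) + block_mx R1 0 0 R2) ->
  exists2 c : R, 0 <= c & forall e1 e1' e2 e2' nu nu',
    lyapunov e1' e2' nu' + decrease e1 e1' e2 e2' <= lyapunov e1 e2 nu ->
    dot e1' e1' + dot e2' e2' + dot nu' nu' <= c * lyapunov e1 e2 nu.
Proof.
rewrite !add_block_mx => /posdef_blocks[/posdef_coercive[c1 c10 c1P]].
move=> /posdef_coercive[c2 c20 c2P].
have bV0 : 0 < beta^-1 by rewrite invr_gt0.
have scale (x w : R) : beta * x <= w -> x <= beta^-1 * w.
  by rewrite mulrC ler_pdivlMl // mulrC.
exists (c1 * (6 + 4 * beta^-1) + c2 * (3 + beta^-1) + beta).
  by rewrite !addr_ge0 ?mulr_ge0 ?addr_ge0 ?mulr_ge0 ?(ltW bV0) ?(ltW beta_gt0).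
move=> e1 e1' e2 e2' nu nu' h.
have := lyapunov_ge0 e1 e2 nu; set W := lyapunov e1 e2 nu in h * => W0.
have A2e2 : dot (A2 *m e2) (A2 *m e2) <= beta^-1 * W.
  apply: scale; rewrite /W /lyapunov.
  have := R1_psd.2 e1; have := R2_psd.2 e2; have := H22_psd.2 e2.
  have := mulr_ge0 (ltW bV0) (dotvv_ge0 nu); lra.
have := R1_psd.2 e1'; have := R2_psd.2 e2'; have := H22_psd.2 e2'.
have := mulr_ge0 (ltW bV0) (dotvv_ge0 nu').
have := mulr_ge0 (ltW beta_gt0) (dotvv_ge0 (A2 *m e2')).
have := S1_psd.2 e1'; have := S2_psd.2 e2'.
have := R1_psd.2 (e1' - e1); have := R2_psd.2 (e2' - e2).
have := mulr_ge0 (ltW beta_gt0) (dotvv_ge0 (A1 *m e1' + A2 *m e2)).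
have := H_psd.2 (col_mx e1' e2'); have := H_psd.2 (col_mx e1' e2).
move: h; rewrite {1}/lyapunov /decrease => h p1 p2 p3 p4 p5 p6 p7 p8 p9 p10 p11 p12.
have A2e2' : dot (A2 *m e2') (A2 *m e2') <= beta^-1 * W by apply: scale; lra.
have Ae : dot (A1 *m e1' + A2 *m e2) (A1 *m e1' + A2 *m e2) <= beta^-1 * W.
  by apply: scale; lra.
have nuW : dot nu' nu' <= beta * W.
  by rewrite -ler_pdivrMl //; lra.
have H11e1 : sqnorm H11 e1' <= 4 * W.
  have := sqnormD_le (col_mx e1' e2') (col_mx 0 (- e2')) H_psd.
  rewrite add_col_mx addr0 subrr !sqnorm_block !mulmx0 !dot0l !addr0 !add0r.
  move: p1 p2 h; rewrite !sqnorm_block mulmxN dotNl dotNr opprK.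
  by rewrite -/(sqnorm H11 e1') -/(sqnorm H22 e2'); lra.
have A1e1 : dot (A1 *m e1') (A1 *m e1') <= 4 * (beta^-1 * W).
  have psd1 : psd (1%:M : 'M[R]_m).
    by split=> [|v]; rewrite ?trmx1 // sqnorm1E dotvv_ge0.
  have := sqnormD_le (A1 *m e1' + A2 *m e2) (- (A2 *m e2)) psd1.
  by rewrite addrK !sqnorm1E dotNl dotNr opprK; lra.
have b1 : dot e1' e1' <= c1 * ((6 + 4 * beta^-1) * W).
  by apply: le_trans (c1P _) _; rewrite ler_wpM2l // sqnorm_augment; lra.
have b2 : dot e2' e2' <= c2 * ((3 + beta^-1) * W).
  by apply: le_trans (c2P _) _; rewrite ler_wpM2l // sqnorm_augment; lra.
lra.
Qed.

(** H annihilates both (e1', e2') and (e1', e2), hence also their difference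
    (0, e2' - e2); this separates H12 and H22. *)
Lemma decrease_eq0 e1 e1' e2 e2' : decrease e1 e1' e2 e2' = 0 ->
  [/\ R1 *m (e1' - e1) = 0, R2 *m (e2' - e2) = 0, A1 *m e1' + A2 *m e2 = 0,
    H12 *m (e2' - e2) = 0 & H22 *m (e2' - e2) = 0].
Proof.
rewrite /decrease.
have := S1_psd.2 e1'; have := S2_psd.2 e2'.
have := R1_psd.2 (e1' - e1); have := R2_psd.2 (e2' - e2).
have := mulr_ge0 (ltW beta_gt0) (dotvv_ge0 (A1 *m e1' + A2 *m e2)).
have := H_psd.2 (col_mx e1' e2'); have := H_psd.2 (col_mx e1' e2).
move=> p1 p2 p3 p4 p5 p6 p7 D0.
have : H12 *m (e2' - e2) = 0 /\ H22 *m (e2' - e2) = 0.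
  have /(psd_sqnorm_eq0 H_psd) : sqnorm (block_mx H11 H12 H12^T H22) (col_mx e1' e2') = 0 by lra.
  have /(psd_sqnorm_eq0 H_psd) : sqnorm (block_mx H11 H12 H12^T H22) (col_mx e1' e2) = 0 by lra.
  move=> h h'; have : block_mx H11 H12 H12^T H22 *m (col_mx e1' e2' - col_mx e1' e2) = 0.
    by rewrite mulmxBr h h' subrr.
  rewrite opp_col_mx add_col_mx subrr mul_block_col !mulmx0 !add0r => /eqP.
  by rewrite col_mx_eq0 => /andP[/eqP ? /eqP ?].
case=> h12 h22; split=> //.
- by apply: psd_sqnorm_eq0 => //; lra.
- by apply: psd_sqnorm_eq0 => //; lra.
- apply: dotvv_eq0; apply: (mulfI (lt0r_neq0 beta_gt0)); rewrite mulr0; lra.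
Qed.

Section Iterates.
Variables (theta1 : 'cV[R]_d1 -> \bar R) (theta2 : 'cV[R]_d2 -> \bar R).
Variables (x1 : nat -> 'cV[R]_d1) (x2 : nat -> 'cV[R]_d2) (mu : nat -> 'cV[R]_m).
Hypotheses (theta1_cpc : closed_proper_convex theta1)
  (theta2_cpc : closed_proper_convex theta2).
Hypotheses (S1_mono : subdiff_monotone theta1 S1)
  (S2_mono : subdiff_monotone theta2 S2).
Hypothesis generated : prox_ADMM theta1 theta2 phi A1 A2 b beta R1 R2 x1 x2 mu.

Local Notation isKKT := (KKT theta1 theta2 phi A1 A2 b).

Lemma KKTE y1 y2 nu : isKKT y1 y2 nu <->
  [/\ subdifferential theta1 y1 (- phi_grad1 y1 y2 + A1^T *m nu),
      subdifferential theta2 y2 (- phi_grad2 y1 y2 + A2^T *m nu)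
    & A1 *m y1 + A2 *m y2 = b].
Proof.
rewrite /KKT (quadratic_at_gradient (quadratic_at_phi1 y1 y2)).
by rewrite (quadratic_at_gradient (quadratic_at_phi2 y1 y2)).
Qed.

Lemma iterate_subdifferential1 k :
  subdifferential theta1 (x1 k.+1) (- prox_grad1 (x1 k) (x1 k.+1) (x2 k) (mu k)).
Proof.
have [p c _] := theta1_cpc; have [h _ _] := generated k.
exact: argmin_subdifferential p c (quadratic_at_prox1 _ _ _ _) h.
Qed.

Lemma iterate_subdifferential2 k :
  subdifferential theta2 (x2 k.+1)
    (- prox_grad2 (x1 k.+1) (x2 k) (x2 k.+1) (mu k)).
Proof.
have [p c _] := theta2_cpc; have [_ h _] := generated k.
exact: argmin_subdifferential p c (quadratic_at_prox2 _ _ _ _) h.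
Qed.

Lemma iterates_decrease y1 y2 nu k : isKKT y1 y2 nu ->
  lyapunov (x1 k.+1 - y1) (x2 k.+1 - y2) (mu k.+1 - nu)
  + decrease (x1 k - y1) (x1 k.+1 - y1) (x2 k - y2) (x2 k.+1 - y2)
  <= lyapunov (x1 k - y1) (x2 k - y2) (mu k - nu).
Proof.
move=> /KKTE[k1 k2 kb].
have [p1 _ _] := theta1_cpc; have [p2 _ _] := theta2_cpc.
have i1 := iterate_subdifferential1 k; have i2 := iterate_subdifferential2 k.
have := S1_mono (subdifferential_edom p1 i1) (subdifferential_edom p1 k1) i1 k1.
have := S2_mono (subdifferential_edom p2 i2) (subdifferential_edom p2 k2) i2 k2.
have [_ _ ->] := generated k; rewrite -kb => h2 h1.
apply: lyapunov_decrease.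
- apply: le_trans h1 _; rewrite le_eqVlt; apply/predU1P; left.
  move: {1 2}(x1 k.+1 - y1) => e; rewrite /prox_grad1 /phi_grad1 -kb.
  by rewrite !(mulmxDr, mulmxN, mulmxZr, dotDr, dotNr, dotZr); ring.
- apply: le_trans h2 _; rewrite le_eqVlt; apply/predU1P; left.
  move: {1 2}(x2 k.+1 - y2) => e; rewrite /prox_grad2 /phi_grad2 -kb.
  by rewrite !(mulmxDr, mulmxN, mulmxZr, dotDr, dotNr, dotZr); ring.
rewrite !mulmxBr addrAC; congr (_ - beta *: _).
by rewrite opprD addrACA.
Qed.

Hypothesis sum_posdef : posdef (block_mx H11 0 0 H22 + block_mx S1 0 0 S2
  + block_mx (A1^T *m A1) 0 0 (A2^T *m A2) + block_mx R1 0 0 R2).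

Lemma iterates_le y1 y2 nu : isKKT y1 y2 nu ->
  exists2 c, 0 <= c & forall k,
  dot (x1 k.+1 - y1) (x1 k.+1 - y1) + dot (x2 k.+1 - y2) (x2 k.+1 - y2)
  + dot (mu k.+1 - nu) (mu k.+1 - nu)
  <= c * lyapunov (x1 k - y1) (x2 k - y2) (mu k - nu).
Proof.
move=> kkt; have [c c0 cP] := lyapunov_coercive sum_posdef.
by exists c => // k; apply: cP (iterates_decrease k kkt).
Qed.

(** Convergence along any proper filter upgrades to convergence of the whole
    sequence, because the energy relative to the limit is nonincreasing. *)
Lemma iterates_cvg y1 y2 nu (F : set_system nat) {FF : ProperFilter F} :
  isKKT y1 y2 nu ->
  x1 k @[k --> F] --> y1 -> x2 k @[k --> F] --> y2 -> mu k @[k --> F] --> nu ->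
  (x1 k, x2 k, mu k) @[k --> \oo] --> (y1, y2, nu).
Proof.
move=> kkt x1F x2F muF; have [c c0 cP] := iterates_le kkt.
pose V k := lyapunov (x1 k - y1) (x2 k - y2) (mu k - nu).
have V0 : V k @[k --> \oo] --> (0 : R).
  apply: (nonincreasing_cvg0 (F := F)) => [k|k|].
  - exact: lyapunov_ge0.
  - have := iterates_decrease k kkt.
    have := decrease_ge0 (x1 k - y1) (x1 k.+1 - y1) (x2 k - y2) (x2 k.+1 - y2).
    by rewrite /V; lra.
  - have -> : 0 = lyapunov (y1 - y1) (y2 - y2) (nu - nu).
      by rewrite /lyapunov /sqnorm !subrr !mulmx0 !dot0l; ring.
    have d1F : x1 k - y1 @[k --> F] --> y1 - y1 by apply: cvgB => //; exact: cvg_cst.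
    have d2F : x2 k - y2 @[k --> F] --> y2 - y2 by apply: cvgB => //; exact: cvg_cst.
    have dmF : mu k - nu @[k --> F] --> nu - nu by apply: cvgB => //; exact: cvg_cst.
    exact: cvg_lyapunov.
have cV0 : c * V k @[k --> \oo] --> (0 : R).
  by rewrite -(mulr0 c); apply: cvgM => //; exact: cvg_cst.
have step n (u : nat -> 'cV[R]_n) (l : 'cV[R]_n) :
    (forall k, dot (u k.+1 - l) (u k.+1 - l) <= c * V k) -> u k @[k --> \oo] --> l.
  move=> uV; rewrite -(cvg_shiftS u); apply: cvg_dot0.
  apply: (squeeze_cvgr _ (cvg_cst 0) cV0); apply: nearW => k.
  by rewrite dotvv_ge0 uV.
have x1c : x1 k @[k --> \oo] --> y1.
  apply: step => k; apply: le_trans (cP k).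
  by rewrite -addrA lerDl addr_ge0 ?dotvv_ge0.
have x2c : x2 k @[k --> \oo] --> y2.
  apply: step => k; apply: le_trans (cP k).
  by rewrite addrAC lerDr addr_ge0 ?dotvv_ge0.
have muc : mu k @[k --> \oo] --> nu.
  apply: step => k; apply: le_trans (cP k).
  by rewrite lerDr addr_ge0 ?dotvv_ge0.
exact: cvg_pair (cvg_pair x1c x2c) muc.
Qed.

(** The points a, b and c stand for three consecutive iterates which no longer
    decrease the energy. All terms of the optimality conditions at c that
    differ from the KKT conditions vanish by [decrease_eq0], except those
    with A2 (c2 - b2). Monotonicity of the subdifferential of theta2 between
    b2 and c2 eliminates them: the multipliers at b and c differ by
    - beta A2 (c2 - b2), so that the inner product which monotonicity requires
    to be nonnegative equals - beta |A2 (c2 - b2)|^2. *)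
Lemma fixed_point_KKT a1 a2 b1 b2 c1 c2 mua mub muc y1 y2 nu :
  isKKT y1 y2 nu ->
  subdifferential theta2 b2 (- prox_grad2 b1 a2 b2 mua) ->
  subdifferential theta1 c1 (- prox_grad1 b1 c1 b2 mub) ->
  subdifferential theta2 c2 (- prox_grad2 c1 b2 c2 mub) ->
  mub = mua - beta *: (A1 *m b1 + A2 *m b2 - b) ->
  muc = mub - beta *: (A1 *m c1 + A2 *m c2 - b) ->
  decrease (a1 - y1) (b1 - y1) (a2 - y2) (b2 - y2) = 0 ->
  decrease (b1 - y1) (c1 - y1) (b2 - y2) (c2 - y2) = 0 ->
  isKKT c1 c2 muc.
Proof.
have subrK' (n : nat) (u v w : 'cV[R]_n) : (u - w) - (v - w) = u - v.
  by rewrite opprB addrA subrK.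
move=> /KKTE[_ _ yb] sb2 sc1 sc2 mubE mucE.
move=> /decrease_eq0[_ R2b _ _ _] /decrease_eq0[R1c R2c Ac H12c H22c].
rewrite !subrK' in R2b R1c R2c H12c H22c.
have {}Ac : A1 *m c1 + A2 *m b2 = b.
  by apply/eqP; rewrite -subr_eq0 -Ac !mulmxBr addrACA -opprD yb.
have [p2 _ _] := theta2_cpc.
have dmu : muc - mub = - (beta *: (A2 *m (c2 - b2))).
  rewrite mucE addrC addKr mulmxBr -Ac; congr (- (_ *: _)).
  by rewrite opprD addrACA subrr add0r.
have A2c : A2 *m (c2 - b2) = 0.
  have := S2_mono (subdifferential_edom p2 sc2) (subdifferential_edom p2 sb2) sc2 sb2.
  rewrite (prox_grad2E _ mubE) (prox_grad2E _ mucE) R2b R2c !addr0 => h.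
  have E e : dot e (- (phi_grad2 c1 c2 - A2^T *m muc) -
      - (phi_grad2 b1 b2 - A2^T *m mub)) =
      dot e (A2^T *m (muc - mub)) - dot e (H12^T *m (c1 - b1))
      - dot e (H22 *m (c2 - b2)).
    by rewrite /phi_grad2 !(mulmxDr, mulmxN, dotDr, dotNr); ring.
  have {h} := le_trans (S2_psd.2 _) h.
  rewrite E !dot_trmx H12c H22c dmu dot0l (dotC (c2 - b2)) dot0l !subr0.
  rewrite dotNr dotZr oppr_ge0.
  rewrite pmulr_rle0 // => h; apply: dotvv_eq0; apply/eqP.
  by rewrite eq_le h dotvv_ge0.
have {dmu}muE : muc = mub by apply/eqP; rewrite -subr_eq0 dmu A2c scaler0 oppr0.
apply/KKTE; split.
- move: sc1; rewrite /prox_grad1 Ac subrr mulmx0 scaler0 addr0 R1c addr0 muE.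
  have -> : phi_grad1 c1 b2 = phi_grad1 c1 c2.
    by congr (_ + _ + _); apply/esym/eqP; rewrite -subr_eq0 -mulmxBr H12c.
  by rewrite opprB addrC.
- by move: sc2; rewrite (prox_grad2E _ mucE) R2c addr0 opprB addrC.
- by move: A2c; rewrite mulmxBr => /eqP; rewrite subr_eq0 => /eqP ->.
Qed.

(** Optimality of an iterate involves the previous one, and [fixed_point_KKT]
    compares two optimality conditions for theta2. Hence limits of three
    consecutive iterates are needed; indices start at 1, as the bounds do not
    cover the arbitrary initial point. *)
Lemma exists_cluster_KKT : (exists y1 y2 nu, isKKT y1 y2 nu) ->
  exists y1 y2 nu, isKKT y1 y2 nu /\
  exists2 F : set_system nat, ProperFilter F &
    [/\ x1 k @[k --> F] --> y1, x2 k @[k --> F] --> y2 & mu k @[k --> F] --> nu].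
Proof.
case=> y1 [y2 [nu kkt]].
have [U [UU leU]] := @ultraFilterLemma nat \oo _.
pose V k := lyapunov (x1 k - y1) (x2 k - y2) (mu k - nu).
pose D k := decrease (x1 k - y1) (x1 k.+1 - y1) (x2 k - y2) (x2 k.+1 - y2).
have VD k : V k.+1 + D k <= V k by exact: iterates_decrease.
have Vge0 k : 0 <= V k by exact: lyapunov_ge0.
have Dge0 k : 0 <= D k by exact: decrease_ge0.
have D0 := nonincreasing_gap_cvg0 Vge0 Dge0 VD.
have V0 k : V k <= V 0%N.
  by elim: k => // k; apply: le_trans; have := VD k; have := Dge0 k; lra.
have [c c0 cP] := iterates_le kkt.
have bounded k : dot (x1 k.+1 - y1) (x1 k.+1 - y1)
    + dot (x2 k.+1 - y2) (x2 k.+1 - y2)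
    + dot (mu k.+1 - nu) (mu k.+1 - nu) <= c * V 0%N.
  by apply: le_trans (cP k) _; rewrite ler_wpM2l ?V0.
have lim n (u : nat -> 'cV[R]_n) (y : 'cV[R]_n) :
    (forall k, dot (u k.+1 - y) (u k.+1 - y) <= c * V 0%N) ->
    forall j, exists l : 'cV[R]_n, u (j + k).+1 @[k --> U] --> l.
  move=> uV j; have [l ul] := ultra_bounded_cvg (fun k => uV (j + k)%N).
  exists (l + y); under eq_fun do rewrite -[u _](subrK y).
  by apply: cvgD => //; exact: cvg_cst.
have lim1 : forall j, exists l : 'cV[R]_d1, x1 (j + k).+1 @[k --> U] --> l.
  apply: (lim _ _ y1) => k; apply: le_trans (bounded k).
  by rewrite -addrA lerDl addr_ge0 ?dotvv_ge0.
have lim2 : forall j, exists l : 'cV[R]_d2, x2 (j + k).+1 @[k --> U] --> l.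
  apply: (lim _ _ y2) => k; apply: le_trans (bounded k).
  by rewrite addrAC lerDr addr_ge0 ?dotvv_ge0.
have limm : forall j, exists l : 'cV[R]_m, mu (j + k).+1 @[k --> U] --> l.
  apply: (lim _ _ nu) => k; apply: le_trans (bounded k).
  by rewrite lerDr addr_ge0 ?dotvv_ge0.
have /choice[l1 l1P] := lim1; have /choice[l2 l2P] := lim2.
have /choice[lm lmP] := limm.
exists (l1 2), (l2 2), (lm 2); split; last first.
  exists ((fun k => (2 + k).+1) @ U); first exact: fmap_proper_filter.
  by split; [exact: l1P|exact: l2P|exact: lmP].
have lmS j : lm j.+1 = lm j - beta *: (A1 *m l1 j.+1 + A2 *m l2 j.+1 - b).
  suff L : mu (j.+1 + k).+1 @[k --> U]
      --> lm j - beta *: (A1 *m l1 j.+1 + A2 *m l2 j.+1 - b).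
    exact: cvg_unique (lmP j.+1) L.
  have -> : (fun k => mu (j.+1 + k).+1) = (fun k => mu (j + k).+1
      - beta *: (A1 *m x1 (j.+1 + k).+1 + A2 *m x2 (j.+1 + k).+1 - b)).
    by apply/funext => k; have [_ _ ->] := generated (j.+1 + k).
  apply: cvgB; first exact: lmP.
  exact: (cvgZr (cvgB (cvgD (cvg_mulmx A1 (l1P j.+1))
    (cvg_mulmx A2 (l2P j.+1))) (cvg_cst b))).
have decr0 j :
    decrease (l1 j - y1) (l1 j.+1 - y1) (l2 j - y2) (l2 j.+1 - y2) = 0.
  have e1 i : x1 (i + k).+1 - y1 @[k --> U] --> l1 i - y1.
    by apply: cvgB; [exact: l1P|exact: cvg_cst].
  have e2 i : x2 (i + k).+1 - y2 @[k --> U] --> l2 i - y2.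
    by apply: cvgB; [exact: l2P|exact: cvg_cst].
  suff L : D (j + k).+1 @[k --> U] --> (0 : R).
    exact: cvg_unique (cvg_decrease (e1 j) (e1 j.+1) (e2 j) (e2 j.+1)) L.
  have : D (k + j.+1)%N @[k --> \oo] --> (0 : R).
    exact: cvg_comp (@cvg_addnr _) D0.
  have -> : (fun k => D (k + j.+1)%N) = (fun k => D (j + k).+1).
    by apply/funext => k; rewrite addnC.
  by move=> Doo A /Doo; exact: leU.
have [[p1 _] _ c1] := theta1_cpc; have [[p2 _] _ c2] := theta2_cpc.
have sub1 j : subdifferential theta1 (l1 j.+1)
    (- prox_grad1 (l1 j) (l1 j.+1) (l2 j) (lm j)).
  apply: (subdifferential_closed p1 c1 _ (l1P j.+1)
    (cvg_prox_grad1 (l1P j) (l1P j.+1) (l2P j) (lmP j))).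
  by move=> k; exact: iterate_subdifferential1.
have sub2 j : subdifferential theta2 (l2 j.+1)
    (- prox_grad2 (l1 j.+1) (l2 j) (l2 j.+1) (lm j)).
  apply: (subdifferential_closed p2 c2 _ (l2P j.+1)
    (cvg_prox_grad2 (l1P j.+1) (l2P j) (l2P j.+1) (lmP j))).
  by move=> k; exact: iterate_subdifferential2.
exact: (fixed_point_KKT kkt (sub2 0%N) (sub1 1) (sub2 1) (lmS 0%N) (lmS 1)
  (decr0 0%N) (decr0 1)).
Qed.

End Iterates.
End ProximalADMM.

Theorem theorem1 (R : realType) (m d1 d2 : nat)
    (theta1 : 'cV[R]_d1 -> \bar R) (theta2 : 'cV[R]_d2 -> \bar R)
    (A1 : 'M[R]_(m, d1)) (A2 : 'M[R]_(m, d2)) (b : 'cV[R]_m)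
    (g1 : 'cV[R]_d1) (g2 : 'cV[R]_d2)
    (H11 : 'M[R]_d1) (H12 : 'M[R]_(d1, d2)) (H22 : 'M[R]_d2)
    (S1 : 'M[R]_d1) (S2 : 'M[R]_d2)
    (beta : R) (R1 : 'M[R]_d1) (R2 : 'M[R]_d2)
    (x1 : nat -> 'cV[R]_d1) (x2 : nat -> 'cV[R]_d2) (mu : nat -> 'cV[R]_m)
    (phi := quad_coupling H11 H12 H22 g1 g2)
    (theta1_cpc : closed_proper_convex theta1)
    (theta2_cpc : closed_proper_convex theta2)
    (H_psd : psd (block_mx H11 H12 H12^T H22))
    (KKT_nonempty : exists y1 y2 nu, KKT theta1 theta2 phi A1 A2 b y1 y2 nu)
    (S1_psd : psd S1) (S2_psd : psd S2)
    (S1_mono : subdiff_monotone theta1 S1)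
    (S2_mono : subdiff_monotone theta2 S2)
    (beta_gt0 : 0 < beta) (R1_psd : psd R1) (R2_psd : psd R2)
    (sum_posdef : posdef (block_mx H11 0 0 H22 + block_mx S1 0 0 S2
       + block_mx (A1^T *m A1) 0 0 (A2^T *m A2) + block_mx R1 0 0 R2))
    (generated : prox_ADMM theta1 theta2 phi A1 A2 b beta R1 R2 x1 x2 mu) :
  exists y1 y2 nu,
    KKT theta1 theta2 phi A1 A2 b y1 y2 nu /\
    (x1 k, x2 k, mu k) @[k --> \oo] --> (y1, y2, nu).
Proof.
have [y1 [y2 [nu [kkt [F FF [x1F x2F muF]]]]]] :
    exists y1 y2 nu, KKT theta1 theta2 phi A1 A2 b y1 y2 nu /\
    exists2 F : set_system nat, ProperFilter F &
      [/\ x1 k @[k --> F] --> y1, x2 k @[k --> F] --> y2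
        & mu k @[k --> F] --> nu].
  exact: (exists_cluster_KKT H_psd S1_psd S2_psd beta_gt0 R1_psd R2_psd
    theta1_cpc theta2_cpc S1_mono S2_mono generated sum_posdef KKT_nonempty).
exists y1, y2, nu; split => //.
exact: (iterates_cvg H_psd S1_psd S2_psd beta_gt0 R1_psd R2_psd theta1_cpc
  theta2_cpc S1_mono S2_mono generated sum_posdef kkt x1F x2F muF).
Qed.
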